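(* For every positive integer $k$ there exists a number $\phi_k>0$ such that whenever $t_1,\ldots,t_k\in\mathbb{S}^1$ are distinct points lying on an arc of $\mathbb{S}^1$ of length at most $\phi_k$, the set $\mathrm{conv}(\mathrm{SM}_{2k}(t_1),\ldots,\mathrm{SM}_{2k}(t_k))$ is a $(k-1)$-dimensional face of $\mathcal{B}_{2k}$.
   Context: The symmetric moment curve is $\mathrm{SM}_{2k}(t)=(\cos t,\sin t,\cos 3t,\sin 3t,\ldots,\cos(2k-1)t,\sin(2k-1)t)\in\mathbb{R}^{2k}$, regarded as a map on $\mathbb{S}^1=\mathbb{R}/2\pi\mathbb{Z}$ (the unit circle, of total length $2\pi$). $\mathcal{B}_{2k}=\mathrm{conv}(\mathrm{SM}_{2k}(\mathbb{S}^1))$. A face of a convex body is its intersection with a supporting hyperplane. *)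

(* Defs.v *)
From HB Require Import structures.
From mathcomp Require Import all_boot all_order all_algebra.
From mathcomp Require Import all_classical all_reals all_analysis.

Set Implicit Arguments.
Unset Strict Implicit.
Unset Printing Implicit Defensive.

Import Order.TTheory GRing.Theory Num.Theory.

Local Open Scope classical_set_scope.
Local Open Scope ring_scope.

(* A point of the circle S^1 = R / 2 pi Z is given by any of its real
   representatives; equality in S^1 is congruence modulo 2 pi. *)
Definition eq_mod2pi (R : realType) (s t : R) : Prop :=
  exists m : int, s - t = m%:~R * (2 * pi).

Definition is_arc (R : realType) (A : set R) (l : R) : Prop :=
  0 <= l <= 2 * pi /\
  exists a : R, A = [set t | exists2 s, a <= s <= a + l & eq_mod2pi t s].

(* Coordinates 2q and 2q+1 (counted from 0) are cos ((2q+1) t) and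
   sin ((2q+1) t). *)
Definition SM (R : realType) (k : nat) (t : R) : 'rV[R]_(2 * k) :=
  \row_(j < 2 * k)
    (if odd j then sin ((j./2).*2.+1%:R * t) else cos ((j./2).*2.+1%:R * t)).

Definition conv_hull (R : realType) (n : nat) (A : set 'rV[R]_n) :
  set 'rV[R]_n := smallest (@convex_set R 'rV[R]_n) A.

Definition SM_body (R : realType) (k : nat) : set 'rV[R]_(2 * k) :=
  conv_hull (range (@SM R k)).

Arguments SM_body R k : clear implicits.

Definition dotr (R : realType) (n : nat) (u v : 'rV[R]_n) : R :=
  \sum_(i < n) u 0 i * v 0 i.

Definition hyperplane (R : realType) (n : nat) (c : 'rV[R]_n) (a : R) :
  set 'rV[R]_n := [set x | dotr c x = a].

Definition supporting (R : realType) (n : nat) (K : set 'rV[R]_n)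
    (c : 'rV[R]_n) (a : R) : Prop :=
  [/\ c != 0, K `<=` [set x | dotr c x <= a] & K `&` hyperplane c a !=set0].

Definition is_face (R : realType) (n : nat) (K F : set 'rV[R]_n) : Prop :=
  exists (c : 'rV[R]_n) (a : R), supporting K c a /\ F = K `&` hyperplane c a.

Definition aff_hull (R : realType) (n : nat) (A : set 'rV[R]_n) :
    set 'rV[R]_n :=
  [set x | exists (m : nat) (w : 'I_m -> R) (p : 'I_m -> 'rV[R]_n),
     [/\ forall i, A (p i), \sum_(i < m) w i = 1
       & x = \sum_(i < m) w i *: p i]].

(* The dimension of a (nonempty) set is that of the direction space of its
   affine hull. *)
Definition has_dim (R : realType) (n : nat) (A : set 'rV[R]_n) (d : nat) :
    Prop :=
  exists (x0 : 'rV[R]_n) (V : {vspace 'rV[R]_n}),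
    aff_hull A = [set x0 + v | v in [set` V]] /\ \dim V = d.

Lemma SM_mod2pi (R : realType) (k : nat) (s t : R) :
  eq_mod2pi s t -> SM k s = SM k t.
Proof.
have per (f : R -> R) : periodic f (pi *+ 2) ->
    forall (m : int) x, f (x + m%:~R * (pi *+ 2)) = f x.
  move=> pf [] m x; first by rewrite -pmulrn mulr_natl periodicn.
  rewrite NegzE mulrNz -pmulrn mulNr mulr_natl.
  by rewrite -[LHS](periodicn pf m.+1) subrK.
case=> m /eqP; rewrite subr_eq addrC => /eqP ->.
apply/rowP => j; rewrite !mxE mulrDr mulrA -(natr1 (_.*2)%N).
set q := (j./2).*2.
have -> : (q%:R + 1) * m%:~R * (2 * pi) = (q.+1%:Z * m)%:~R * (pi *+ 2) :> R.
  by rewrite intrM -pmulrn natr1 -[pi *+ 2]mulr_natl.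
by case: ifP => _; apply: per; [exact: sinD2pi|exact: cosD2pi].
Qed.

(* Main.v *)
(** Call "odd" a trigonometric polynomial with only the frequencies
    1, 3, ..., 2k-1; these are the linear forms evaluated on SM_2k, and odd
    polynomials are exactly the combinations of products of 2k-1 (or fewer, but
    oddly many) linear forms in cos t, sin t.

    Take phi = pi/4 and points x_0 < ... < x_(k-1) in [a, a + phi]. The products
    of the k factors sin (t - x_i) with the forms of degree k-1 in
    cos (t - a), sin (t - a) make up a k-dimensional space of odd polynomials, so
    one of them, nonzero, has an odd antiderivative G satisfying the k-1
    conditions G x_(i+1) = G x_i. By Rolle, G' has a further zero y_i between x_i
    and x_(i+1), and since a form of degree k-1 has at most k-1 zeros,
    G' = l * prod_i sin (t - x_i) * prod_i sin (t - y_i), where we may take l > 0.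
    The signs of G' show that G is minimal exactly at the x_i on
    [x_0, x_0 + pi]. On the rest of the circle use G (t + pi) = - G t: it remains
    to see that G < - G x_0 = G (x_0 + pi) on [x_0, x_(k-1)], which follows by
    comparing G' with its translate by pi/2. So G - G x_0 defines a supporting
    hyperplane touching the curve precisely at the given points.

    The k vertices are linearly independent because an odd polynomial can
    vanish at all but one of them. *)

Require Import Defs.
From mathcomp Require Import all_boot all_order all_algebra.
From mathcomp Require Import all_classical all_reals all_analysis.
From mathcomp Require Import ring lra zify.

Import Order.TTheory GRing.Theory Num.Theory.
Import numFieldNormedType.Exports.

Local Open Scope classical_set_scope.
Local Open Scope ring_scope.

(** * Binary forms with known roots *)

(** [m] distinct roots force the nonzero polynomial to have degree exactly [m], so it splits;
    evaluating at [s / e] and multiplying by [e ^+ m] gives the form. It is applied with [s], [e]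
    the sine and cosine of [t - a]. *)
Lemma homogenization_factor (F : fieldType) (m : nat) (u : nat -> F) (rs : seq F) :
  size rs = m -> uniq rs -> all (root (\poly_(j < m.+1) u j)) rs ->
  \poly_(j < m.+1) u j != 0 ->
  exists2 c, c != 0 & forall s e,
    \sum_(j < m.+1) u j * (s ^+ j * e ^+ (m - j)) = c * \prod_(r <- rs) (s - r * e).
Proof.
set Q := \poly_(j < _) _ => szrs urs rootQ Q0.
have szQ : size Q = m.+1.
  by apply/eqP; rewrite eqn_leq size_poly -szrs max_poly_roots.
have QE : Q = lead_coef Q *: \prod_(z <- rs) ('X - z%:P).
  by apply: all_roots_prod_XsubC; rewrite ?szrs // uniq_rootsE.
exists (lead_coef Q); rewrite ?lead_coef_eq0 // => s e.
(* At [e = 0] only the top term survives, and both sides are the leading coefficient times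
   [s ^+ m]. *)
have [->|e0] := eqVneq e 0.
  rewrite big_ord_recr /= subnn expr0 mulr1 big1 ?add0r => [|j _]; last first.
    by rewrite expr0n subn_eq0 leqNgt ltn_ord !mulr0.
  under [in RHS]eq_bigr do rewrite mulr0 subr0.
  by rewrite big_const_seq count_predT szrs iter_mulr_1 lead_coefE szQ coef_poly ltnSn.
have -> : \sum_(j < m.+1) u j * (s ^+ j * e ^+ (m - j)) = e ^+ m * Q.[s / e].
  rewrite horner_poly mulr_sumr; apply: eq_bigr => j _.
  have jm : (j <= m)%N by rewrite -ltnS.
  rewrite expr_div_n (_ : e ^+ m = e ^+ (m - j) * e ^+ j); last by rewrite -exprD subnK.
  by field; rewrite expf_neq0.
rewrite {1}QE hornerZ horner_prod mulrCA; congr (_ * _).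
rewrite -[in e ^+ m]szrs -iter_mulr_1 -(count_predT rs) -big_const_seq -big_split /=.
by apply: eq_bigr => r _; rewrite !hornerE; field.
Qed.

(** * Odd trigonometric polynomials: sums, products, antiderivatives *)

Section OddTrigonometricPolynomials.
Variable R : realType.
Implicit Types (g h G : R -> R) (t x y c : R) (k m q : nat).

Definition odd_trig k g := exists a b : nat -> R, forall t,
  g t = \sum_(q < k) (a q * cos (q.*2.+1%:R * t) + b q * sin (q.*2.+1%:R * t)).

Lemma sum_ord_pairs k (F : nat -> R) :
  \sum_(j < 2 * k) F j = \sum_(q < k) (F q.*2 + F q.*2.+1).
Proof.
elim: k => [|k IH]; first by rewrite !big_ord0.
by rewrite mulnS addnC addn2 !big_ord_recr /= IH mul2n addrA.
Qed.

Lemma odd_trig_dotr k g : odd_trig k g ->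
  exists c : 'rV[R]_(2 * k), forall t, dotr c (SM k t) = g t.
Proof.
move=> [a [b gE]].
exists (\row_(j < 2 * k) if odd j then b j./2 else a j./2) => t.
rewrite gE /dotr; under eq_bigr do rewrite !mxE.
rewrite (sum_ord_pairs k (fun j => (if odd j then b j./2 else a j./2) *
  (if odd j then sin (j./2.*2.+1%:R * t) else cos (j./2.*2.+1%:R * t)))).
by apply: eq_bigr => q _; rewrite /= odd_double /= uphalf_double doubleK.
Qed.

Lemma odd_trig_ext k g h : (forall t, g t = h t) -> odd_trig k g -> odd_trig k h.
Proof. by move=> gh [a [b gE]]; exists a, b => t; rewrite -gh. Qed.

Lemma odd_trig0 k : odd_trig k (fun=> 0).
Proof.
by exists (fun=> 0), (fun=> 0) => t; rewrite big1 // => q _; rewrite !mul0r addr0.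
Qed.

Lemma odd_trigD k g h : odd_trig k g -> odd_trig k h ->
  odd_trig k (fun t => g t + h t).
Proof.
move=> [a [b gE]] [a' [b' hE]].
exists (fun q => a q + a' q), (fun q => b q + b' q) => t.
by rewrite gE hE -big_split /=; apply: eq_bigr => q _; ring.
Qed.

Lemma odd_trigZ k c g : odd_trig k g -> odd_trig k (fun t => c * g t).
Proof.
move=> [a [b gE]]; exists (fun q => c * a q), (fun q => c * b q) => t.
by rewrite gE mulr_sumr; apply: eq_bigr => q _; ring.
Qed.

Lemma odd_trig_sum k n (F : 'I_n -> R -> R) : (forall i, odd_trig k (F i)) ->
  odd_trig k (fun t => \sum_(i < n) F i t).
Proof.
elim: n F => [|n IH] F FV.
  by apply: odd_trig_ext (odd_trig0 k) => t; rewrite big_ord0.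
apply: odd_trig_ext (odd_trigD _ _ _ (IH _ (fun i => FV (widen_ord (leqnSn n) i)))
  (FV ord_max)) => t.
by rewrite big_ord_recr.
Qed.

Lemma odd_trig_cos k q : (q < k)%N -> odd_trig k (fun t => cos (q.*2.+1%:R * t)).
Proof.
move=> qk; exists (fun i => (i == q)%:R), (fun=> 0) => t.
rewrite (bigD1 (Ordinal qk)) //= eqxx big1; first by rewrite mul1r mul0r !addr0.
by move=> i /negbTE; rewrite -val_eqE /= => ->; rewrite !mul0r addr0.
Qed.

Lemma odd_trig_sin k q : (q < k)%N -> odd_trig k (fun t => sin (q.*2.+1%:R * t)).
Proof.
move=> qk; exists (fun=> 0), (fun i => (i == q)%:R) => t.
rewrite (bigD1 (Ordinal qk)) //= eqxx big1; first by rewrite mul1r mul0r add0r addr0.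
by move=> i /negbTE; rewrite -val_eqE /= => ->; rewrite !mul0r addr0.
Qed.

(** By the product-to-sum formulas a frequency n turns into n + 2 and n - 2. For n = 1 the lower one
    is -1, which the parity of cosine and sine folds back to 1. *)
Lemma odd_trig_mulcos2 k g : odd_trig k g ->
  odd_trig k.+1 (fun t => g t * cos (2 * t)).
Proof.
move=> [a [b gE]].
pose F (q : 'I_k) t := a q * (cos (q.*2.+1%:R * t) * cos (2 * t)) +
  b q * (sin (q.*2.+1%:R * t) * cos (2 * t)).
apply: (@odd_trig_ext _ (fun t => \sum_(q < k) F q t)) => [t|].
  by rewrite gE mulr_suml; apply: eq_bigr => q _; rewrite /F; ring.
apply: odd_trig_sum => -[q qk]; rewrite /F /=; apply: odd_trigD; apply: odd_trigZ.
- apply: (@odd_trig_ext _ (fun t => 2^-1 * (cos (q.+1.*2.+1%:R * t) +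
    cos (q.*2.+1%:R * t - 2 * t)))) => [t|].
    rewrite cosB (_ : q.+1.*2.+1%:R * t = q.*2.+1%:R * t + 2 * t); last first.
      by rewrite -mulrDl -natrD addn2 doubleS.
    by rewrite cosD; field.
  apply/odd_trigZ/odd_trigD; first exact: odd_trig_cos.
  case: q qk => [|q] qk.
    apply: odd_trig_ext (odd_trig_cos k.+1 0 isT) => t.
    by rewrite -[RHS]cosN; congr cos; rewrite double0; ring.
  apply: odd_trig_ext (odd_trig_cos k.+1 q _) => [t|]; last by lia.
  congr cos; rewrite -mulrBl; congr (_ * _).
  by rewrite doubleS -(addn2 q.*2.+1) natrD addrK.
- apply: (@odd_trig_ext _ (fun t => 2^-1 * (sin (q.+1.*2.+1%:R * t) +
    sin (q.*2.+1%:R * t - 2 * t)))) => [t|].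
    rewrite sinB (_ : q.+1.*2.+1%:R * t = q.*2.+1%:R * t + 2 * t); last first.
      by rewrite -mulrDl -natrD addn2 doubleS.
    by rewrite sinD; field.
  apply/odd_trigZ/odd_trigD; first exact: odd_trig_sin.
  case: q qk => [|q] qk.
    apply: odd_trig_ext (odd_trigZ _ (-1) _ (odd_trig_sin k.+1 0 isT)) => t.
    by rewrite mulN1r -sinN; congr sin; rewrite double0; ring.
  apply: odd_trig_ext (odd_trig_sin k.+1 q _) => [t|]; last by lia.
  congr sin; rewrite -mulrBl; congr (_ * _).
  by rewrite doubleS -(addn2 q.*2.+1) natrD addrK.
Qed.

Lemma odd_trig_widen k m g : (k <= m)%N -> odd_trig k g -> odd_trig m g.
Proof.
move=> km [a [b gE]]; apply: (@odd_trig_ext _ (fun t => \sum_(q < k)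
  (a q * cos (q.*2.+1%:R * t) + b q * sin (q.*2.+1%:R * t)))) => [t|].
  by rewrite gE.
apply: odd_trig_sum => q; have qm := leq_trans (ltn_ord q) km.
by apply: odd_trigD; apply: odd_trigZ; [exact: odd_trig_cos|exact: odd_trig_sin].
Qed.

Lemma odd_trig_shift k c g : odd_trig k g -> odd_trig k (fun t => g (t + c)).
Proof.
move=> [a [b gE]]; pose n (q : 'I_k) : R := q.*2.+1%:R.
apply: (@odd_trig_ext _ (fun t => \sum_(q < k)
  ((a q * cos (n q * c) + b q * sin (n q * c)) * cos (n q * t) +
   (b q * cos (n q * c) - a q * sin (n q * c)) * sin (n q * t)))) => [t|].
  by rewrite gE; apply: eq_bigr => q _; rewrite mulrDr cosD sinD -/(n q); ring.
apply: odd_trig_sum => q; have qm := ltn_ord q.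
by apply: odd_trigD; apply: odd_trigZ; [exact: odd_trig_cos|exact: odd_trig_sin].
Qed.

(** The function sin 2t is cos 2t translated by pi/4, and translations preserve odd polynomials. *)
Lemma odd_trig_mulsin2 k g : odd_trig k g ->
  odd_trig k.+1 (fun t => g t * sin (2 * t)).
Proof.
move=> gV; apply: (@odd_trig_ext _ (fun t =>
  g ((t - pi / 4) + pi / 4) * cos (2 * (t - pi / 4)))) => [t|].
  by rewrite subrK -cosBpihalf; congr (_ * cos _); field.
apply: (odd_trig_shift k.+1 (- (pi / 4)) (fun t => g (t + pi / 4) * cos (2 * t))).
exact/odd_trig_mulcos2/odd_trig_shift.
Qed.

Lemma odd_trig1P g : odd_trig 1 g <->
  exists a b : R, forall t, g t = a * cos t + b * sin t.
Proof.
split=> [[a [b gE]]|[a [b gE]]].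
  by exists (a 0%N), (b 0%N) => t; rewrite gE big_ord1 /= mul1r.
by exists (fun=> a), (fun=> b) => t; rewrite gE big_ord1 /= mul1r.
Qed.

Lemma odd_trig1_cos x : odd_trig 1 (fun t => cos (t - x)).
Proof.
apply/odd_trig1P; exists (cos x), (sin x) => t.
by rewrite cosB; ring.
Qed.

Lemma odd_trig1_sin x : odd_trig 1 (fun t => sin (t - x)).
Proof.
apply/odd_trig1P; exists (- sin x), (cos x) => t.
by rewrite sinB; ring.
Qed.

(** A product of two linear forms in cos t, sin t is a combination of 1, cos 2t and sin 2t. *)
Lemma odd_trig_mul2 k g h1 h2 : odd_trig k g -> odd_trig 1 h1 ->
  odd_trig 1 h2 -> odd_trig k.+1 (fun t => g t * (h1 t * h2 t)).
Proof.
move=> gV /odd_trig1P[a [b h1E]] /odd_trig1P[c [d h2E]].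
apply: (@odd_trig_ext _ (fun t => (a * c + b * d) / 2 * g t +
  ((a * c - b * d) / 2 * (g t * cos (2 * t)) +
   (a * d + b * c) / 2 * (g t * sin (2 * t))))) => [t|].
  rewrite mulr_natl cos_mulr2n sin_mulr2n h1E h2E.
  have C2 : cos t * cos t = 1 - sin t * sin t by rewrite -!expr2 cos2sin2.
  by field : C2.
apply: odd_trigD; first exact/odd_trigZ/(odd_trig_widen k).
by apply: odd_trigD; apply: odd_trigZ;
  [exact: odd_trig_mulcos2|exact: odd_trig_mulsin2].
Qed.

(** Each further pair of linear forms raises the top frequency by at most two. The default [fun=> 0]
    of [nth] is itself a linear form, so quantifying over all [i] asks nothing beyond the entries of
    [s]. *)
Lemma odd_trig_prod m (s : seq (R -> R)) : size s = m.*2.+1 ->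
  (forall i, odd_trig 1 (nth (fun=> 0) s i)) ->
  odd_trig m.+1 (fun t => \prod_(h <- s) h t).
Proof.
elim: m s => [|m IH] [|h1 [|h2 s]] //= ss sV.
  by apply: odd_trig_ext (sV 0%N) => t; rewrite big_seq1.
apply: odd_trig_ext (odd_trig_mul2 m.+1 _ _ _ (IH s _ _) (sV 0%N) (sV 1%N)).
- by move=> t; rewrite !big_cons /=; ring.
- by move: ss => [].
- by move=> i; exact: (sV i.+2).
Qed.

Lemma odd_trig_alternating k g : odd_trig k g -> alternating g pi.
Proof.
move=> [a [b gE]] t; rewrite !gE -sumrN; apply: eq_bigr => q _.
have -> : q.*2.+1%:R * (t + pi) = (q.*2.+1%:R * t) + pi *+ q.*2.+1.
  by rewrite mulrDr -[pi *+ _]mulr_natl.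
rewrite (alternatingn (@cosDpi R)) (alternatingn (@sinDpi R)).
by rewrite exprS -mul2n exprM sqrrN !expr1n; ring.
Qed.

(** Frequency 0 does not occur, so integrating termwise only divides by odd numbers and stays in the
    same space. *)
Lemma odd_trig_antiderivative k g : odd_trig k g ->
  exists G, odd_trig k G /\ forall t, is_derive t 1 G (g t).
Proof.
move=> [a [b gE]]; pose n (q : 'I_k) : R := q.*2.+1%:R.
pose F (q : 'I_k) : R -> R := fun t =>
  a q / n q * sin (n q * t) + (- b q / n q) * cos (n q * t).
exists (\sum_(q < k) F q); split.
  apply: (@odd_trig_ext _ (fun t => \sum_(q < k) F q t)) => [t|].
    by rewrite fct_sumE.
  apply: odd_trig_sum => q; have qm := ltn_ord q.
  by apply: odd_trigD; apply: odd_trigZ; [exact: odd_trig_sin|exact: odd_trig_cos].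
move=> t; rewrite gE; apply: is_derive_sum => q.
have n0 : n q != 0 by rewrite pnatr_eq0.
rewrite -/(n q) /F.
have H1 : is_derive t 1 (fun t => n q * t) (n q).
  have := @is_deriveZ R R R id (n q) t 1 1 (is_derive_id t 1).
  by rewrite /GRing.scale /= mulr1.
have H2 := is_derive1_comp (f := sin) (is_derive_sin (n q * t)) H1.
have H3 := is_derive1_comp (f := cos) (is_derive_cos (n q * t)) H1.
have := is_deriveD (is_deriveZ (a q / n q) H2) (is_deriveZ (- b q / n q) H3).
rewrite /GRing.scale /=.
by move/is_derive_eq; apply; field.
Qed.

(** * Constructing G with equal values at the given points *)

Lemma mean_value G g u v : (forall t, is_derive t 1 G (g t)) -> u < v ->
  exists2 c, u < c < v & G v - G u = g c * (v - u).
Proof.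
move=> Gg uv.
have [|c cuv cE] := @MVT R G g u v uv (fun x _ => Gg x).
  apply/continuous_subspaceT => z.
  by apply/differentiable_continuous/derivable1_diffP; case: (Gg z).
by exists c; rewrite // in_itv /= in cuv.
Qed.

Lemma sin_neq0 t : - pi < t < pi -> t != 0 -> sin t != 0.
Proof.
move=> tpi; rewrite neq_lt => /orP[t0|t0]; last by rewrite gt_eqF // sin_gt0_pi; lra.
by rewrite -oppr_eq0 -sinN gt_eqF // sin_gt0_pi; lra.
Qed.

(** This is G' up to a scalar. The pairing exposes its sign: for interlaced roots on a short arc,
    pair [j] is negative, on the half turn after [x 0], only between [y j] and [x j.+1]. *)
Definition interlaced_product m (x y : nat -> R) t :=
  sin (t - x 0%N) * \prod_(j < m) (sin (t - y j) * sin (t - x j.+1)).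

(** There are [m.+1] + [m] linear factors in all, an odd number. The family over all [j] supplies
    the candidates for G'; the case [j = 0] later separates one vertex from the others. *)
Lemma odd_trig_monomial m j (x : nat -> R) a : (j <= m)%N ->
  odd_trig m.+1 (fun t => \prod_(i < m.+1) sin (t - x i) *
    (sin (t - a) ^+ j * cos (t - a) ^+ (m - j))).
Proof.
move=> jm.
pose s := mkseq (fun i t => sin (t - x i)) m.+1 ++
  (nseq j (fun t => sin (t - a)) ++ nseq (m - j) (fun t => cos (t - a))).
apply: (@odd_trig_ext _ (fun t => \prod_(h <- s) h t)) => [t|].
  rewrite /s !big_cat /= !big_nseq !iter_mulr_1 big_map.
  by rewrite -[RHS](congr1 (fun z => z * _) (big_mkord xpredT (fun i => sin (t - x i)))).
apply: odd_trig_prod => [|i].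
  by rewrite !size_cat size_mkseq !size_nseq subnKC // addSn addnn.
rewrite !nth_cat size_mkseq size_nseq !nth_nseq.
have [im|_] := ltnP i m.+1; first by rewrite nth_mkseq //; exact: odd_trig1_sin.
have [_|_] := ltnP (i - m.+1) j; first exact: odd_trig1_sin.
by case: ifP => _; [exact: odd_trig1_cos|exact: odd_trig0].
Qed.

Lemma interlaced_antiderivative m (a : R) (x : nat -> R) :
  (forall i j, (i < j < m.+1)%N -> x i < x j) ->
  (forall i, (i < m.+1)%N -> a <= x i <= a + pi / 4) ->
  exists (G : R -> R) (y : nat -> R) (l : R), [/\ odd_trig m.+1 G, 0 < l,
    forall j, (j < m)%N -> x j < y j < x j.+1,
    forall j, (j < m)%N -> G (x j.+1) = G (x j) &
    forall t, is_derive t 1 G (l * interlaced_product m x y t)].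
Proof.
move=> xinc xa; have pi0 := pi_gt0 R.
pose b (j : 'I_m.+1) t := \prod_(i < m.+1) sin (t - x i) *
  (sin (t - a) ^+ j * cos (t - a) ^+ (m - j)).
have /choice[B bB] (j : 'I_m.+1) :
    exists B, odd_trig m.+1 B /\ forall t, is_derive t 1 B (b j t).
  by apply/odd_trig_antiderivative/odd_trig_monomial; rewrite -ltnS.
(* One row per candidate, one column per condition [G (x i.+1) = G (x i)]. With more rows than
   columns there is a nonzero left kernel vector, which gives the coefficients of [G]. *)
pose A : 'M[R]_(m.+1, m) := \matrix_(j, i) (B j (x i.+1) - B j (x i)).
have : kermx A != 0.
  rewrite kermx_eq0 /row_free neq_ltn; apply/orP; left.
  by rewrite ltnS rank_leq_col.
case/rowV0Pn => v /sub_kermxP vA v0.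
(* Indexing by [nat] fits [\poly]; only [j <= m] occurs, where [inord] is faithful. *)
pose u j : R := v 0 (inord j).
pose G := \sum_(j < m.+1) (u j \*: B j).
have GE t : G t = \sum_(j < m.+1) u j * B j t by rewrite /G fct_sumE.
pose q t := \sum_(j < m.+1) u j * (sin (t - a) ^+ j * cos (t - a) ^+ (m - j)).
have dG t : is_derive t 1 G (\prod_(i < m.+1) sin (t - x i) * q t).
  have -> : \prod_(i < m.+1) sin (t - x i) * q t = \sum_(j < m.+1) u j *: b j t.
    by rewrite mulr_sumr; apply: eq_bigr => j _; rewrite /b /GRing.scale /=; ring.
  by apply: is_derive_sum => j; apply: is_deriveZ; case: (bB j).
have GV : odd_trig m.+1 G.
  apply: (@odd_trig_ext _ (fun t => \sum_(j < m.+1) u j * B j t)) => [t|].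
    by rewrite GE.
  apply: (@odd_trig_sum _ _ (fun j t => u j * B j t)) => j.
  by apply: odd_trigZ; case: (bB j).
have Gx j : (j < m)%N -> G (x j.+1) = G (x j).
  move=> jm; have /rowP/(_ (Ordinal jm)) := vA.
  rewrite !mxE /= => /eqP; rewrite -subr_eq0 subr0.
  rewrite (_ : \sum_(_ < _) _ = G (x j.+1) - G (x j)) ?subr_eq0 => [/eqP//|].
  rewrite !GE -sumrB; apply: eq_bigr => i _.
  by rewrite !mxE /u inord_val mulrBr.
have xmem i t : (i < m)%N -> x i < t < x i.+1 -> a < t < a + pi / 4.
  move=> im tx; have := xa _ (ltnW im); have := xa i.+1 im; lra.
have cos_neq0 t : a < t < a + pi / 4 -> cos (t - a) != 0.
  by move=> ta; rewrite gt_eqF // cos_gt0_pihalf; lra.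
(* Rolle: the zero of G' found strictly between consecutive points differs from every [x i] by less
   than pi and by a nonzero amount, so no sine factor vanishes there and [q] must. *)
have /choice[y yP] (j : nat) : exists y, (j < m)%N -> x j < y < x j.+1 /\ q y = 0.
  have [jm|_] := ltnP j m; last by exists 0.
  have xj : x j < x j.+1 by apply: xinc; rewrite ltnSn.
  have [y yx] := mean_value _ _ _ _ dG xj.
  rewrite Gx // subrr => /esym/eqP.
  rewrite mulf_eq0 subr_eq0 [x j.+1 == _]gt_eqF // orbF mulf_eq0 => /orP[|/eqP qy].
    case/prodf_eq0 => i _ si; suff: sin (y - x i) != 0 by rewrite si.
    have := xa i (ltn_ord i); have ya := xmem _ _ jm yx => xia.
    apply: sin_neq0; first by lra.
    rewrite subr_eq0; have [ij|ij] := leqP i j.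
      have : x i <= x j.
        move: ij; rewrite leq_eqVlt => /orP[/eqP ->//|ij].
        by apply/ltW/xinc; rewrite ij ltnW.
      by move=> ?; rewrite gt_eqF //; lra.
    have : x j.+1 <= x i.
      move: ij; rewrite leq_eqVlt => /orP[/eqP ->//|ij].
      by apply/ltW/xinc; rewrite ij ltn_ord.
    by move=> ?; rewrite lt_eqF //; lra.
  by exists y.
have yx j : (j < m)%N -> x j < y j < x j.+1 by move=> /yP[].
have qy j : (j < m)%N -> q (y j) = 0 by move=> /yP[].
have yinc i j : (i < j < m)%N -> y i < y j.
  case/andP => ij jm; have := yx _ jm; have := yx _ (ltn_trans ij jm).
  have : x i.+1 <= x j.
    move: ij; rewrite leq_eqVlt => /orP[/eqP ->//|ij].
    by apply/ltW/xinc; rewrite ij ltnW.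
  lra.
have ya j : (j < m)%N -> a < y j < a + pi / 4 by move=> jm; exact: xmem (yx _ jm).
have cosy j : (j < m)%N -> cos (y j - a) != 0 by move=> jm; exact/cos_neq0/ya.
(* [q t] is [cos (t - a) ^+ m] times the polynomial with coefficients [u] at [tan (t - a)] wherever
   the cosine is nonzero. The tangents at the [y j] are thus roots, distinct because [tan] is
   injective on (-pi/2, pi/2). *)
have [||||c c0 qE] := @homogenization_factor R m u [seq tan (y j - a) | j <- iota 0 m].
- by rewrite size_map size_iota.
- rewrite map_inj_in_uniq ?iota_uniq // => i j; rewrite !mem_iota /= add0n => im jm.
  have yi := ya _ im; have yj := ya _ jm.
  move=> tij; have /addIr yij : y i - a = y j - a.
    by apply: tan_inj tij; rewrite in_itv /=; lra.
  case: (ltngtP i j) => // ij.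
    by have := yinc i j; rewrite ij jm yij ltxx => /(_ isT).
  by have := yinc j i; rewrite ij im yij ltxx => /(_ isT).
- apply/allP => _ /mapP[j + ->]; rewrite mem_iota /= add0n => jm.
  rewrite /root horner_poly.
  have : cos (y j - a) ^+ m * (\sum_(i < m.+1) u i * tan (y j - a) ^+ i) == 0.
    rewrite -[X in _ == X](qy _ jm) mulr_sumr; apply/eqP/eq_bigr => i _.
    rewrite /tan expr_div_n (_ : cos (y j - a) ^+ m =
      cos (y j - a) ^+ (m - i) * cos (y j - a) ^+ i).
      by field; rewrite expf_neq0 ?cosy.
    by rewrite -exprD subnK // -ltnS.
  by rewrite mulf_eq0 expf_eq0 (negbTE (cosy _ jm)) andbF.
- apply: contra_neq v0 => Q0; apply/rowP => j; rewrite mxE.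
  by have := coef_poly m.+1 u j; rewrite Q0 coef0 ltn_ord /u inord_val.
(* Since sin (t - a) - tan (y - a) cos (t - a) = sin (t - y) / cos (y - a), the product of these
   cosines is the constant to divide by. *)
pose C := \prod_(j < m) cos (y j - a).
have C0 : C != 0 by apply/prodf_neq0 => j _; exact: cosy.
have gE t : \prod_(i < m.+1) sin (t - x i) * q t = c / C * interlaced_product m x y t.
  rewrite /q qE big_map -[iota 0 m]/(iota 0 (0 + m)) -[(0 + m)%N]subn0.
  rewrite -/(index_iota 0 m) big_mkord big_ord_recl.
  rewrite /interlaced_product big_split /= /C.
  have -> : \prod_(j < m) (sin (t - a) - tan (y j - a) * cos (t - a)) =
      (\prod_(j < m) sin (t - y j)) / \prod_(j < m) cos (y j - a).
    rewrite -prodf_div; apply: eq_bigr => j _.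
    rewrite (_ : t - y j = (t - a) - (y j - a)); last by ring.
    by rewrite [sin (_ - (_ - _))]sinB /tan; field; exact: cosy.
  ring.
(* Passing to [- G] keeps every condition and makes the scalar positive. *)
have [l0|l0] : c / C < 0 \/ 0 < c / C.
  by apply/orP; rewrite -neq_lt mulf_neq0 ?invr_eq0.
- exists (- G), y, (- (c / C)); split => //.
  + by apply: odd_trig_ext (odd_trigZ _ (-1) _ GV) => t; rewrite mulN1r.
  + by rewrite oppr_gt0.
  + by move=> j jm /=; rewrite /GRing.opp /= Gx.
  + by move=> t; rewrite mulNr -gE; exact: is_deriveN.
- exists G, y, (c / C); split => //.
  + by move=> t; rewrite -gE.
Qed.

(** * Congruence modulo 2 pi and position among the given points *)

Lemma odd_trig_eq_mod2pi k G s t : odd_trig k G -> eq_mod2pi s t -> G s = G t.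
Proof. by move=> /odd_trig_dotr[c cG] st; rewrite -!cG (SM_mod2pi _ st). Qed.

Lemma eq_mod2pi_sym (s t : R) : eq_mod2pi s t -> eq_mod2pi t s.
Proof. by case=> n e; exists (- n); rewrite mulrNz mulNr -e opprB. Qed.

Lemma eq_mod2pi_trans (r s t : R) : eq_mod2pi r s -> eq_mod2pi s t -> eq_mod2pi r t.
Proof.
move=> [n e] [n' e']; exists (n + n').
by rewrite intrD mulrDl -e -e' addrA subrK.
Qed.

Lemma eq_mod2pi_itv (b t : R) : exists2 s, b <= s < b + 2 * pi & eq_mod2pi t s.
Proof.
have pi0 := pi_gt0 R; pose n := Num.floor ((t - b) / (2 * pi)).
exists (t - n%:~R * (2 * pi)); last by exists n; ring.
have p0 : 0 < 2 * pi :> R by lra.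
have /andP[] := floor_itv ((t - b) / (2 * pi)).
rewrite -/n ler_pdivlMr // ltr_pdivrMr // intrD mulrDl mul1r; lra.
Qed.

Lemma between_consecutive n (x : nat -> R) t : x 0%N <= t <= x n ->
  exists2 i, (i <= n)%N & t = x i \/ (i < n)%N /\ x i < t < x i.+1.
Proof.
elim: n => [|n IH] xt; first by exists 0%N => //; left; lra.
have [xnt|] := ltP (x n) t; last first.
  move=> tx; have [|i ni ti] := IH; first by lra.
  by exists i; [exact: leqW|case: ti => [|[? ?]]; [left|right; split=> //; exact: leqW]].
have [->|ne] := eqVneq t (x n.+1); first by exists n.+1 => //; left.
by exists n => //; right; split=> //; rewrite xnt lt_neqAle ne; lra.
Qed.

(** Squaring reduces this to cos^2 t - sin^2 t = cos 2t >= 0. Here the arc length pi/4 is used in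
    full. *)
Lemma normr_sin_le_cos t : - (pi / 4) <= t <= pi / 4 -> `|sin t| <= cos t.
Proof.
move=> tpi; have pi0 := pi_gt0 R.
have c0 : 0 <= cos t by apply: cos_ge0_pihalf; lra.
rewrite -(@ler_pXn2r _ 2) ?nnegrE // real_normK ?num_real //.
have : 0 <= cos (t *+ 2) by apply: cos_ge0_pihalf; lra.
by rewrite cos_mulr2n sin2cos2; lra.
Qed.

(** * G is minimal exactly at the given points *)

Section Interlaced.
Variables (m : nat) (a l : R) (x y : nat -> R) (G : R -> R).
Hypothesis xinc : forall i j, (i < j < m.+1)%N -> x i < x j.
Hypothesis xa : forall i, (i < m.+1)%N -> a <= x i <= a + pi / 4.
Hypothesis GV : odd_trig m.+1 G.
Hypothesis l0 : 0 < l.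
Hypothesis yx : forall j, (j < m)%N -> x j < y j < x j.+1.
Hypothesis Gx : forall j, (j < m)%N -> G (x j.+1) = G (x j).
Hypothesis dG : forall t, is_derive t 1 G (l * interlaced_product m x y t).

Let x_le i j : (i <= j)%N -> (j < m.+1)%N -> x i <= x j.
Proof.
rewrite leq_eqVlt => /orP[/eqP -> //|ij] jm.
by apply/ltW/xinc; rewrite ij.
Qed.

Let Gxi i : (i < m.+1)%N -> G (x i) = G (x 0%N).
Proof. by elim: i => // i IH im; rewrite Gx // IH // ltnW. Qed.

Let Gpi : alternating G pi := odd_trig_alternating _ _ GV.

(** [t] lies on the same side of both roots and within pi of each, so the two sines share their
    sign. *)
Let factor_gt0 j t : (j < m)%N -> x 0%N < t < x 0%N + pi -> t < y j \/ x j.+1 < t ->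
  0 < sin (t - y j) * sin (t - x j.+1).
Proof.
move=> jm tx; have := yx j jm; have := xa 0%N isT; have := xa j.+1 jm.
have := x_le 0 j isT (ltnW jm) => ? ? ? ?.
case=> tj; last by rewrite mulr_gt0 // sin_gt0_pi; lra.
by rewrite -mulrNN -!sinN mulr_gt0 // sin_gt0_pi; lra.
Qed.

Let prod_gt0 t : x 0%N < t < x 0%N + pi ->
  (forall j, (j < m)%N -> t < y j \/ x j.+1 < t) ->
  0 < l * interlaced_product m x y t.
Proof.
move=> tx tj; rewrite mulr_gt0 // mulr_gt0 //; first by rewrite sin_gt0_pi; lra.
by apply: prodr_gt0 => j _; apply: factor_gt0 => //; exact: tj.
Qed.

(** Only pair [i] has sines of opposite signs; [t] lies outside the interval of every other pair. *)
Let prod_lt0 i t : (i < m)%N -> y i < t < x i.+1 ->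
  l * interlaced_product m x y t < 0.
Proof.
move=> im ti; have := yx i im; have := xa 0%N isT; have := xa i.+1 im.
have := x_le 0 i isT (ltnW im) => *.
rewrite pmulr_rlt0 // pmulr_rlt0; last by rewrite sin_gt0_pi; lra.
rewrite (bigD1 (Ordinal im)) //= nmulr_rlt0; last first.
  rewrite pmulr_rlt0; last by rewrite sin_gt0_pi; lra.
  by rewrite -oppr_gt0 -sinN sin_gt0_pi; lra.
apply: prodr_gt0 => j ji; apply: factor_gt0 => //; first by lra.
have := yx j (ltn_ord j); move: ji; rewrite -val_eqE /= neq_ltn => /orP[ji|ij].
  by have := x_le j.+1 i ji (ltnW im); right; lra.
by have := x_le i.+1 j ij (ltnW (ltn_ord j)); left; lra.
Qed.

(** [G] increases from [x i] to [y i], then decreases to [x i.+1], and takes the value [G (x 0)] at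
    both ends. *)
Let G_gt i t : (i < m)%N -> x i < t < x i.+1 -> G (x 0%N) < G t.
Proof.
move=> im ti; rewrite -(Gxi i (ltnW im)).
have := yx i im; have := xa 0%N isT; have := xa i.+1 im.
have := x_le 0 i isT (ltnW im) => *.
have [ty|yt] := leP t (y i).
  have xt : x i < t by lra.
  have [c cx] := mean_value _ _ _ _ dG xt.
  move/eqP; rewrite subr_eq => /eqP ->; rewrite ltrDr mulr_gt0 //; last by lra.
  apply: prod_gt0 => [|j jm]; first by lra.
  have := yx j jm; have [ij|ij] := leqP i j.
    move: ij; rewrite leq_eqVlt => /orP[/eqP <-|ij]; first by left; lra.
    by have := x_le i.+1 j ij (ltnW jm); left; lra.
  by have := x_le j.+1 i ij (ltnW im); right; lra.
have tx : t < x i.+1 by lra.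
have [c cx] := mean_value _ _ _ _ dG tx.
rewrite Gx // => /eqP; rewrite subr_eq addrC -subr_eq => /eqP <-.
rewrite ltrBrDr gtrDl nmulr_rlt0 ?subr_gt0 //.
by apply: (prod_lt0 i) => //; lra.
Qed.

(** Past the last root [x m] and before [x 0 + pi], every sine in G' is positive. *)
Let G_incr u v : x m <= u -> u < v -> v <= x 0%N + pi -> G u < G v.
Proof.
move=> xu uv vx; have [c cx] := mean_value _ _ _ _ dG uv.
rewrite -subr_gt0 => ->; rewrite mulr_gt0 ?subr_gt0 //.
have := x_le 0 m isT (ltnSn m) => *.
apply: prod_gt0 => [|j jm]; first by lra.
by have := x_le j.+1 m jm (ltnSn m); right; lra.
Qed.

(** [t] and each root [z] share an arc of length pi/4, so |sin (t - z)| <= cos (t - z) = sin (t +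
    pi/2 - z), factor by factor. *)
Let prod_shift t : a <= t <= a + pi / 4 ->
  interlaced_product m x y t <= interlaced_product m x y (t + pi / 2).
Proof.
move=> ta.
have E z : a <= z <= a + pi / 4 -> `|sin (t - z)| <= sin (t + pi / 2 - z).
  move=> za; rewrite addrAC sinDpihalf; apply: normr_sin_le_cos; lra.
apply: le_trans (ler_norm _) _; rewrite normrM normr_prod.
apply: ler_pM => //; first by apply: prodr_ge0 => j _.
  exact/E/xa.
apply: ler_prod => j _; rewrite normr_ge0 normrM /=.
have := xa j (ltnW (ltn_ord j)); have := xa j.+1 (ltn_ord j).
have := yx j (ltn_ord j) => *.
by apply: ler_pM => //; apply: E; lra.
Qed.

(* [G (t + pi / 2) - G t] is nondecreasing on the arc, since there
   [|sin (t - s)| <= cos (t - s)] for each of the roots [s] of [G']. *)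
Let G_lt u : x 0%N <= u <= x m -> G u < - G (x 0%N).
Proof.
move=> ux; have pi0 := pi_gt0 R; have := xa 0%N isT; have := xa m (ltnSn m) => ? ?.
rewrite -Gpi.
have H1 : G (x m) < G (x 0%N + pi / 2) by apply: G_incr; lra.
have H2 : G (u + pi / 2) < G (x 0%N + pi) by apply: G_incr; lra.
(* It follows that G u <= G (u + pi/2) - (G (x 0 + pi/2) - G (x 0)), where the bracket is positive
   by [H1] and the first term is below G (x 0 + pi) by [H2]. *)
suff : G (x 0%N + pi / 2) - G (x 0%N) <= G (u + pi / 2) - G u.
  by move: H1; rewrite Gxi //; lra.
have [->//|xu] := eqVneq (x 0%N) u.
have {}xu : x 0%N < u by rewrite lt_neqAle xu; lra.
pose H t := G (t + pi / 2) - G t.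
have dH t : is_derive t 1 H (l * interlaced_product m x y (t + pi / 2) -
    l * interlaced_product m x y t).
  have dGs := @is_derive1_comp R G (shift (pi / 2)) t _ _ (dG (t + pi / 2))
    (is_derive_shift t 1 (pi / 2)).
  by have := is_deriveB dGs (dG t); rewrite mulr1.
have [c cx] := mean_value _ _ _ _ dH xu.
rewrite -[_ <= _]subr_ge0 -/(H u) -/(H (x 0%N)) => ->.
rewrite mulr_ge0 //; last by lra.
by rewrite -mulrBr mulr_ge0 ?subr_ge0 //; [exact: ltW|apply: prod_shift; lra].
Qed.

Let G_ge_period t : x 0%N <= t < x 0%N + 2 * pi ->
  G (x 0%N) < G t \/ exists2 i, (i < m.+1)%N & t = x i.
Proof.
move=> tx; have pi0 := pi_gt0 R; have := xa 0%N isT.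
have := xa m (ltnSn m); have := x_le 0 m isT (ltnSn m) => *.
have [tm|tm] := leP t (x m).
  have [|i im] := between_consecutive m x t; first by lra.
  by case=> [->|[{}im ti]]; [right; exists i|left; exact: (G_gt i)].
left; have [tp|tp] := leP t (x 0%N + pi).
  by rewrite -(Gxi m) //; apply: G_incr.
(* On the second half turn the claim becomes G (t - pi) < - G (x 0) = G (x 0 + pi), by [G_lt] up to
   [x m] and by monotonicity after it. *)
rewrite -[t](subrK pi) Gpi; have [tmp|tmp] := leP (t - pi) (x m).
  by rewrite -ltrNr; apply: G_lt; lra.
by rewrite -ltrNr -Gpi; apply: G_incr; lra.
Qed.

Lemma interlaced_minimum t :
  G (x 0%N) <= G t ?= iff `[< exists2 i, (i < m.+1)%N & eq_mod2pi t (x i) >].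
Proof.
have [s sx ts] := eq_mod2pi_itv (x 0%N) t.
rewrite (odd_trig_eq_mod2pi _ _ _ _ GV ts).
case: asboolP => [[i im tx]|ne].
  have sxi : eq_mod2pi s (x i) by exact: eq_mod2pi_trans (eq_mod2pi_sym _ _ ts) tx.
  by rewrite (odd_trig_eq_mod2pi _ _ _ _ GV sxi) Gxi //; split; rewrite ?eqxx.
have [Gs|[i im si]] := G_ge_period s sx.
  by split; [exact: ltW|exact: lt_eqF].
by case: ne; exists i => //; rewrite -si.
Qed.

End Interlaced.

Lemma trig_minimum m (a : R) (x : nat -> R) :
  (forall i j, (i < j < m.+1)%N -> x i < x j) ->
  (forall i, (i < m.+1)%N -> a <= x i <= a + pi / 4) ->
  exists2 G, odd_trig m.+1 G & forall t,
  G (x 0%N) <= G t ?= iff `[< exists2 i, (i < m.+1)%N & eq_mod2pi t (x i) >].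
Proof.
move=> xinc xa.
have [G [y [l [GV l0 yx Gx dG]]]] := interlaced_antiderivative _ _ _ xinc xa.
by exists G => // t; exact: (interlaced_minimum m a l x y G).
Qed.

End OddTrigonometricPolynomials.

(** * Faces and dimension of convex hulls *)

Section ConvexHull.
Variables (R : realType) (n : nat).
Implicit Types (A F : set 'rV[R]_n) (c x y : 'rV[R]_n).

Lemma dotrD c x y : dotr c (x + y) = dotr c x + dotr c y.
Proof. by rewrite -big_split; apply: eq_bigr => i _; rewrite mxE mulrDr. Qed.

Lemma dotrZ c (l : R) x : dotr c (l *: x) = l * dotr c x.
Proof. by rewrite mulr_sumr; apply: eq_bigr => i _; rewrite mxE mulrCA. Qed.

Lemma dotr0 c : dotr c 0 = 0.
Proof. by rewrite /dotr big1 // => i _; rewrite mxE mulr0. Qed.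

Lemma dotr_sum c m (p : 'I_m -> 'rV[R]_n) :
  dotr c (\sum_(i < m) p i) = \sum_(i < m) dotr c (p i).
Proof. exact: (big_morph _ (dotrD c) (dotr0 c)). Qed.

Lemma convex_set_of_comb A :
  (forall x y (l : R), 0 <= l <= 1 -> A x -> A y -> A (l *: x + (1 - l) *: y)) ->
  @convex_set R 'rV[R]_n A.
Proof.
move=> cA x y l; rewrite !in_setE => Ax Ay.
by apply: cA => //; rewrite ge0 le1.
Qed.

Lemma conv_hull_convex A : @convex_set R 'rV[R]_n (conv_hull A).
Proof.
move=> x y l; rewrite !in_setE => Ax Ay B [cB AB].
have := cB x y l; rewrite !in_setE; apply; [exact: Ax|exact: Ay].
Qed.

(** The points of [A] off the hyperplane satisfy the strict inequality, and the union of the open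
    half-space with the hull of [F] is convex, so it contains the hull of [A]. *)
Lemma conv_hull_is_face A F c (b : R) : c != 0 -> F !=set0 -> F `<=` A ->
  A `<=` [set x | dotr c x <= b] -> F = A `&` hyperplane c b ->
  is_face (conv_hull A) (conv_hull F).
Proof.
move=> c0 [x0 Fx0] FA Ab FE.
have cvx (P : R -> Prop) : (forall u v l : R, 0 <= l <= 1 -> P u -> P v ->
    P (l * u + (1 - l) * v)) -> @convex_set R 'rV[R]_n [set x | P (dotr c x)].
  move=> PP; apply: convex_set_of_comb => x y l l01 Px Py /=.
  by rewrite dotrD !dotrZ; apply: PP.
have Fb : conv_hull F `<=` hyperplane c b.
  apply: smallest_sub => [|x]; last by rewrite FE => -[].
  by apply: (cvx (fun z => z = b)) => u v l _ -> ->; ring.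
have FhA : conv_hull F `<=` conv_hull A by exact: sub_smallest2r (conv_hull_convex A) FA.
have Ahb : conv_hull A `<=` [set x | dotr c x <= b].
  by apply: smallest_sub => //; apply: (cvx (fun z => z <= b)) => u v l; nra.
exists c, b; split; first split => //.
  by exists x0; split; [apply: sub_gen_smallest; exact: FA|move: Fx0; rewrite FE => -[]].
apply/seteqP; split=> [x Fx|]; first by split; [exact: FhA|exact: Fb].
suff AS : conv_hull A `<=` [set x | dotr c x < b] `|` conv_hull F.
  by move=> x [/AS[/= lt|//] eb]; move: lt; rewrite /hyperplane /= in eb; rewrite eb ltxx.
apply: smallest_sub => [x y l|x Ax].
  rewrite !in_setE => Sx Sy.
  (* The end weights are treated apart, since a strict inequality survives only with positive
     weight. *)
  have [->|l0] := eqVneq l 0%:i01; first by rewrite conv0.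
  have [->|l1] := eqVneq l 1%:i01; first by rewrite conv1.
  have {}l0 : 0 < l%:num by rewrite lt_neqAle eq_sym l0 ge0.
  have {}l1 : l%:num < 1 by rewrite lt_neqAle l1 le1.
  have [[Fx Fy]|lt] : (conv_hull F x /\ conv_hull F y) \/
      dotr c x < b /\ dotr c y <= b \/ dotr c x <= b /\ dotr c y < b.
  - case: Sx Sy => [xb|Fx] [yb|Fy]; last by left.
    + by right; left; split=> //; exact: ltW.
    + by right; left; split=> //; have /= -> := Fb _ Fy.
    + by right; right; split=> //; have /= -> := Fb _ Fx.
  - right; have := conv_hull_convex F x y l; rewrite !in_setE; exact.
  - left; rewrite /= dotrD !dotrZ.
    by case: lt => -[]; move: (dotr c x) (dotr c y) (l%:num) l0 l1 => u v r r0 r1 ? ?;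
      rewrite [ltLHS](_ : _ = r * u + (1 - r) * v) //; nra.
have := Ab _ Ax; rewrite /= le_eqVlt => /orP[/eqP e|lt]; last by left.
by right; apply: sub_gen_smallest; rewrite FE.
Qed.

(** A functional vanishing at all the points but one isolates the coefficient of that point, so the
    differences with [p ord0] form a free family; they span the direction space. *)
Lemma has_dim_conv_hull m (p : 'I_m.+1 -> 'rV[R]_n) :
  (forall i, exists2 c, dotr c (p i) != 0 & forall j, j != i -> dotr c (p j) = 0) ->
  has_dim (conv_hull (range p)) m.
Proof.
move=> sep; pose X := [tuple p (lift ord0 i) - p ord0 | i < m].
exists (p ord0), <<X>>%VS; split; last first.
  suff /eqP -> : free X by rewrite size_tuple.
  apply/freeP => w w0 i.
  have [c ci cj] := sep (lift ord0 i).
  have := congr1 (dotr c) w0; rewrite dotr0 dotr_sum (bigD1 i) //= big1 => [|j ji].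
    rewrite nth_mktuple addr0 dotrZ dotrD -scaleN1r dotrZ (cj ord0) //
      mulr0 addr0 => /eqP.
    by rewrite mulf_eq0 (negbTE ci) orbF => /eqP.
  rewrite nth_mktuple dotrZ dotrD -scaleN1r dotrZ (cj ord0) // (cj (lift ord0 j)).
    by rewrite mulr0 addr0 mulr0.
  by rewrite (inj_eq lift_inj).
have pX i : p i - p ord0 \in <<X>>%VS.
  have [j ->|->] := unliftP ord0 i; last by rewrite subrr mem0v.
  by apply: memv_span; apply/tnthP; exists j; rewrite tnth_mktuple.
have hX : conv_hull (range p) `<=` [set x | x - p ord0 \in <<X>>%VS].
  apply: smallest_sub => [|_ [i _ <-]]; last exact: pX.
  apply: convex_set_of_comb => x y l _ /= xX yX.
  rewrite (_ : _ - _ = l *: (x - p ord0) + (1 - l) *: (y - p ord0)).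
    by apply: memvD; apply: memvZ.
  by apply/rowP => j; rewrite !mxE; ring.
apply/seteqP; split=> [_ [k [w [q [qp w1 ->]]]]|_ [v vX <-]].
  exists (\sum_(i < k) w i *: q i - p ord0); last by rewrite addrC subrK.
  have -> : \sum_(i < k) w i *: q i - p ord0 = \sum_(i < k) w i *: (q i - p ord0).
    under [RHS]eq_bigr do rewrite scalerBr.
    by rewrite sumrB -scaler_suml w1 scale1r.
  by apply: memv_suml => i _; apply: memvZ; exact: (hX _ (qp i)).
(* Barycentric weights: the coordinates of [v] along the differences, and what is missing to 1 at
   [p ord0]. *)
pose w (j : 'I_m.+1) := if unlift ord0 j is Some i then coord X i v
  else 1 - \sum_(i < m) coord X i v.
have w0 : w ord0 = 1 - \sum_(i < m) coord X i v by rewrite /w unlift_none.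
have wl i : w (lift ord0 i) = coord X i v by rewrite /w liftK.
exists m.+1, w, p; split.
- by move=> i; apply: sub_gen_smallest; exists i.
- by rewrite big_ord_recl w0 (eq_bigr _ (fun i _ => wl i)) subrK.
- rewrite big_ord_recl w0 {1}(coord_span vX) scalerBl scale1r -addrA; congr (_ + _).
  rewrite scaler_suml -sumrN -big_split; apply: eq_bigr => i _.
  by rewrite nth_mktuple wl scalerBr addrC.
Qed.

End ConvexHull.

(** * Supporting hyperplane and dimension for points on a short arc *)

Theorem theorem1p2 (R : realType) (k : nat) (hk : (0 < k)%N) :
  exists phi : R, 0 < phi /\
    forall t : 'I_k -> R,
      (forall i j, i != j -> ~ eq_mod2pi (t i) (t j)) ->
      (exists (A : set R) (l : R),
         [/\ is_arc A l, l <= phi & forall i, A (t i)]) ->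
      is_face (SM_body R k) (conv_hull (range (fun i => SM k (t i)))) /\
      has_dim (conv_hull (range (fun i => SM k (t i)))) k.-1.
Proof.
case: k hk => // m _; have pi0 := pi_gt0 R; exists (pi / 4); split; first by lra.
move=> t tdist [A [l [[_ [a ->]] lphi tA]]].
have /choice[s sP] (i : 'I_m.+1) :
    exists s, a <= s <= a + pi / 4 /\ eq_mod2pi (t i) s.
  by have [s sa ts] := tA i; exists s; split=> //; lra.
have sinj : injective s.
  move=> i j sij; apply: contrapT => /eqP /tdist; apply.
  have [_ ti] := sP i; have [_ tj] := sP j; rewrite sij in ti.
  exact: eq_mod2pi_trans ti (eq_mod2pi_sym _ _ _ tj).
(* The construction of [G] wants increasing points, so the representatives in the arc are sorted;
   the set of vertices is unchanged. *)
pose z := sort <=%R [seq s i | i <- enum 'I_m.+1].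
have zP r : r \in z -> exists i, r = s i.
  by rewrite mem_sort => /mapP[i _ ->]; exists i.
have szz : size z = m.+1 by rewrite size_sort size_map size_enum_ord.
have zs : sorted <%R z.
  rewrite lt_sorted_uniq_le sort_sorted; last exact: le_total.
  by rewrite sort_uniq map_inj_uniq ?enum_uniq.
pose x i := nth 0 z i.
have xz i : (i < m.+1)%N -> x i \in z by move=> im; rewrite mem_nth ?szz.
have xinc i j : (i < j < m.+1)%N -> x i < x j.
  case/andP => ij jm; apply: (sorted_ltn_nth lt_trans) => //;
    by rewrite inE szz ?(ltn_trans ij).
have xa i : (i < m.+1)%N -> a <= x i <= a + pi / 4.
  by move=> /xz/zP[j ->]; case: (sP j).
have -> : range (fun i => SM m.+1 (t i)) = range (fun i : 'I_m.+1 => SM m.+1 (x i)).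
  apply/seteqP; split=> [_ [i _ <-]|_ [i _ <-]] /=.
    have /(nthP 0)[j jz xj] : s i \in z by rewrite mem_sort map_f ?mem_enum.
    rewrite szz in jz; exists (Ordinal jz) => //=.
    by rewrite /x xj; apply: esym; apply: SM_mod2pi; case: (sP i).
  have [j xj] := zP _ (xz i (ltn_ord i)).
  by exists j => //; rewrite xj; apply: SM_mod2pi; case: (sP j).
split.
  have [G GV Gmin] := trig_minimum _ _ _ _ xinc xa.
  (* The sign change turns the minimum of [G] into the maximum of a linear functional on the
     curve. *)
  have [c cG] := odd_trig_dotr _ _ _ (odd_trigZ _ _ (-1) _ GV).
  have GP r : G (x 0%N) = G r -> exists2 i, (i < m.+1)%N & eq_mod2pi r (x i).
    by have [_] := Gmin r; move=> + e; rewrite e eqxx => /esym/asboolP.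
  apply: (@conv_hull_is_face _ _ _ _ c (- G (x 0%N))).
  - apply/eqP => c0.
    have G0 r : G r = 0.
      by have := cG r; rewrite c0 /dotr big1 => [|i _]; [lra|rewrite mxE mul0r].
    (* If [G] vanished identically, every point would be a minimum; but [a + pi] exceeds each [x i]
       by an amount strictly between 0 and 2 pi. *)
    have [|i im [n]] := GP (a + pi); first by rewrite !G0.
    have := xa i im => xia en.
    have n0 : (0 < n%:~R :> R) by rewrite -(@pmulr_lgt0 _ (2 * pi)) -?en; lra.
    have n1 : (n%:~R < 1 :> R) by rewrite -(@ltr_pM2r _ (2 * pi)) -?en; lra.
    by move: n0 n1; rewrite ltr0z ltrz1; lia.
  - by exists (SM m.+1 (x 0%N)); exists ord0.
  - by move=> _ [i _ <-]; exists (x i).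
  - by move=> _ [r _ <-] /=; rewrite cG mulN1r lerN2; case: (Gmin r).
  - apply/seteqP; split=> [_ [i _ <-]|_ [[r _ <-]]].
      split; first by exists (x i).
      rewrite /hyperplane /= cG mulN1r; congr (- _); apply/esym/eqP.
      have [_ ->] := Gmin (x i); apply/asboolP; exists i => //.
      by exists 0; rewrite subrr mul0r.
    rewrite /hyperplane /= cG mulN1r => /oppr_inj/esym/GP[i im ri].
    by exists (Ordinal im) => //=; rewrite (SM_mod2pi _ ri).
apply: has_dim_conv_hull => i.
(* [sin (t - (a - pi / 2)) = cos (t - a)], so replacing the root [x i] by
   [a - pi / 2] yields an odd polynomial vanishing at every [x j] but [x i]. *)
pose x' j := if j == i :> nat then a - pi / 2 else x j.
have [c cE] := odd_trig_dotr _ _ _ (odd_trig_monomial R m 0 x' a isT).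
exists c => [|j ji]; rewrite cE.
  have xia := xa i (ltn_ord i).
  have cosx : cos (x i - a) != 0 by rewrite gt_eqF // cos_gt0_pihalf; lra.
  rewrite mul1r subn0 mulf_neq0 ?expf_neq0 //; apply/prodf_neq0 => j _.
  rewrite /x'; have [_|ji] := eqVneq (j : nat) i.
    by rewrite opprB addrA addrAC sinDpihalf.
  have xja := xa j (ltn_ord j).
  apply: sin_neq0; first by lra.
  rewrite subr_eq0 neq_lt; apply/orP; move: ji; rewrite neq_ltn => /orP[ji|ij].
    by right; apply: xinc; rewrite ji ltn_ord.
  by left; apply: xinc; rewrite ij ltn_ord.
rewrite (bigD1 j) //= /x' ifN //= subrr sin0 !mul0r //.
Qed.
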